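(* There exists an integer $n_0>0$ such that for all $n\geq n_0$ the following holds: the unique graph on $2n$ vertices with at least $n^2-1$ edges that does not contain two vertices of the same degree joined by a path of length three is the complete bipartite graph $K_{n-1,n+1}$.
   Context: All graphs are finite and simple. A path of length three is a path with three edges (on four distinct vertices); two vertices are joined by a path of length three if they are the two endpoints of such a path. *)

(* Defs.v *)
From mathcomp Require Import all_boot.

Set Implicit Arguments.
Unset Strict Implicit.
Unset Printing Implicit Defensive.

Record sgraph := SGraph {
  vertex :> finType;
  adj : rel vertex;
  adj_sym : symmetric adj;
  adj_irrefl : irreflexive adj
}.

Definition edges (G : sgraph) : {set {set G}} :=
  [set [set p.1; p.2] | p : G * G & adj p.1 p.2].

Definition degree (G : sgraph) (x : G) : nat := #|[set y | adj x y]|.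

Definition joined_by_P4 (G : sgraph) (x y : G) : Prop :=
  exists a b : G, uniq [:: x; a; b; y] /\ path (@adj G) x [:: a; b; y].

Definition isomorphic (G H : sgraph) : Prop :=
  exists f : G -> H, bijective f /\ forall x y : G, adj (f x) (f y) = adj x y.

Definition Kbip_adj (a b : nat) : rel ('I_a + 'I_b) :=
  fun u v => match u, v with
             | inl _, inr _ | inr _, inl _ => true
             | _, _ => false
             end.

Lemma Kbip_sym (a b : nat) : symmetric (@Kbip_adj a b).
Proof. by case=> x [] y. Qed.

Lemma Kbip_irrefl (a b : nat) : irreflexive (@Kbip_adj a b).
Proof. by case. Qed.

Definition Kbip (a b : nat) : sgraph := SGraph (@Kbip_sym a b) (@Kbip_irrefl a b).

Definition admissible (n : nat) (G : sgraph) : Prop :=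
  [/\ #|G| = 2 * n, n ^ 2 - 1 <= #|edges G|
    & ~ exists x y : G, degree x = degree y /\ joined_by_P4 x y].

(* Main.v *)
(* Let [v] have maximum degree [D = n + k], let [W] be the complement of [N(v)],
   and split [N(v)] into the set [U] of vertices whose degree occurs only once in
   [N(v)] and the rest [R]. An edge [a x] inside [N(v)] yields the paths
   [x a v x'], so there are no edges between [U] and [R], and [R] spans a matching
   whose edges are exactly the degree classes they meet. Hence degrees in [R] are
   at most [|W| = n - k], up to a total excess of 2. Degrees in [U] are distinct,
   and they are smaller than [D]: a second vertex [y] of [U] of degree [D] would
   forbid all edges between [N(v) \ y] and [N(y) \ v], which costs too many edges.
   Adding up degrees, [2 e(G) <= 2 n^2 + 2 - ((2 k - |U|)^2 + |U|) / 2], so [k] and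
   [|U|] are bounded and almost all vertices of [W] (resp. [R]) have the same
   degree [D] (resp. [n - k]). Then an edge inside [W] or inside [N(v)] extends to
   a forbidden path, so [G] is bipartite, and counting edges gives
   [G = K_{n-1,n+1}]. *)

Require Import Defs.
From mathcomp Require Import all_boot.
From mathcomp Require Import zify.

Set Implicit Arguments.
Unset Strict Implicit.
Unset Printing Implicit Defensive.

(** * Double counting and sums of deficits *)

Lemma sum_pairs (T : finType) (P : T -> T -> bool) :
  #|[set p : T * T | P p.1 p.2]| = \sum_x #|[set y | P x y]|.
Proof.
rewrite -sum1_card.
rewrite (eq_bigl (fun p : T * T => xpredT p.1 && P p.1 p.2)); last first.
  by move=> p; rewrite inE.
rewrite -(pair_big_dep xpredT P (fun _ _ => 1)) /=.
apply: eq_bigr => x _; rewrite -sum1_card; apply: eq_bigl => y.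
by rewrite inE.
Qed.

(** Both sides count ordered adjacent pairs: an edge {a, b} comes from exactly (a, b) and (b, a). *)
Lemma handshake (G : sgraph) : \sum_(x : G) degree x = 2 * #|edges G|.
Proof.
rewrite /degree -sum_pairs -sum1_card.
rewrite (partition_big_imset (fun p : G * G => [set p.1; p.2])) /=.
rewrite mulnC -sum_nat_const.
have -> : [set [set p.1; p.2] | p in [set p : G * G | adj p.1 p.2]] = edges G.
  by apply/setP=> E; apply/imsetP/imsetP=> -[p pE ->]; exists p; rewrite // !inE in pE *.
apply: eq_bigr => E /imsetP[[a b] /= ab ->].
rewrite inE /= in ab.
have nab : a != b by apply: contraTneq ab => ->; rewrite adj_irrefl.
rewrite sum1dep_card.
have -> : [set x | (x \in [set p : G * G | adj p.1 p.2]) &&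
     ([set x.1; x.2] == [set a; b])] = [set (a, b); (b, a)].
  apply/setP=> -[c d]; rewrite !inE /= !xpair_eqE; apply/andP/orP.
    case=> cd /eqP/setP e.
    have ncd : c != d by apply: contraTneq cd => ->; rewrite adj_irrefl.
    have := e d; have := e c; rewrite !inE !eqxx orbT /=.
    case/esym/orP=> /eqP ec; case/esym/orP=> /eqP ed; rewrite ec ed ?eqxx; auto.
      by rewrite ec ed eqxx in ncd.
    by rewrite ec ed eqxx in ncd.
  case=> /andP[/eqP-> /eqP->]; rewrite ?ab ?eqxx; split=> //.
    by rewrite adj_sym.
  by apply/eqP; rewrite setUC.
by rewrite cards2 xpair_eqE negb_and nab.
Qed.

(** The extreme case takes the values D - 1, ..., D - |A|. Induction removes an element of largest
    value, which then serves as the strict bound for the rest. *)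
Lemma distinct_sum_bound (T : finType) (A : {set T}) (f : T -> nat) (D : nat) :
  {in A &, injective f} -> {in A, forall x, f x < D} ->
  2 * (\sum_(x in A) f x) + #|A| * #|A|.+1 <= 2 * (#|A| * D).
Proof.
have [m] := ubnP #|A|; elim: m A D => // m IH A D ltm fi fD.
have [->|[x0 x0A]] := set_0Vmem A; first by rewrite big_set0 cards0.
case: (@arg_maxnP _ x0 (mem A) f x0A) => x xA' xmax.
have xA : x \in A := xA'.
have cA : #|A| = #|A :\ x|.+1 by rewrite (cardsD1 x A) xA.
rewrite (big_setD1 x xA) /= cA.
have IH' : 2 * (\sum_(y in A :\ x) f y) + #|A :\ x| * #|A :\ x|.+1
             <= 2 * (#|A :\ x| * f x).
  apply: IH; first by rewrite cA in ltm; lia.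
    by move=> y z /setD1P[_ yA] /setD1P[_ zA]; apply: fi.
  move=> y /setD1P[yx yA]; have le : f y <= f x := xmax y yA.
  rewrite ltn_neqAle le andbT; apply: contra yx => /eqP e.
  by rewrite (fi y x yA xA e).
have := fD x xA; move: IH'; move: (#|A :\ x|) (f x) => a fx.
nia.
Qed.

Lemma card_lt_deficit (T : finType) (A : {set T}) (f : T -> nat) (B : nat) :
  #|[set x in A | f x < B]| <= \sum_(x in A) (B - f x).
Proof.
rewrite -sum1_card (eq_bigl (fun x => (x \in A) && (f x < B))); last first.
  by move=> x; rewrite inE.
rewrite big_mkcondr /=; apply: leq_sum => x _; case: ifP; lia.
Qed.

Lemma deficit_le (T : finType) (A : {set T}) (f : T -> nat) (B : nat) (a : T) :
  a \in A -> B - f a <= \sum_(x in A) (B - f x).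
Proof. by move=> aA; rewrite (big_setD1 a) //= leq_addr. Qed.

Lemma deficitE (T : finType) (A : {set T}) (f : T -> nat) (B : nat) :
  {in A, forall x, f x <= B} ->
  \sum_(x in A) f x + \sum_(x in A) (B - f x) = #|A| * B.
Proof.
move=> fB; rewrite -big_split -sum_nat_const /=.
by apply: eq_bigr => x /fB; lia.
Qed.

(** * Forbidden paths between vertices of equal degree *)

Definition P4_degree_free (G : sgraph) : Prop :=
  forall x y : G, degree x = degree y -> ~ joined_by_P4 x y.

Definition nbh (G : sgraph) (x : G) : {set G} := [set y | adj x y].

Lemma adj_neq (G : sgraph) (x y : G) : adj x y -> x != y.
Proof. by apply: contraTneq => ->; rewrite adj_irrefl. Qed.

Lemma P4_free_path (G : sgraph) (x a b y : G) : P4_degree_free G ->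
  adj x a -> adj a b -> adj b y -> x != b -> a != y -> x != y ->
  degree x = degree y -> False.
Proof.
move=> H xa ab by_ xb ay xy /H; apply; exists a, b; split; last first.
  by rewrite /= xa ab by_.
by rewrite /= !inE !negb_or xb ay xy !adj_neq.
Qed.

(** Two choices at each end leave distinct neighbours x of a and y of b in S, and x a b y is a
    forbidden path. *)
Lemma P4_free_nbh2 (G : sgraph) (S : {set G}) (d : nat) (a b : G) :
  P4_degree_free G -> {in S, forall x, degree x = d} ->
  a \notin S -> b \notin S -> adj a b ->
  1 < #|nbh a :&: S| -> 1 < #|nbh b :&: S| -> False.
Proof.
move=> H Sd aS bS ab /card_gt1P[x [x' [xa _ _]]] /card_gt1P[y [y' [yb y'b yy']]].
move: xa yb y'b; rewrite !inE => /andP[ax xS] /andP[by_ yS] /andP[by' y'S].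
have nS z t : z \in S -> t \notin S -> z != t.
  by move=> zS; apply: contraNneq => <-.
have P z : z \in S -> adj b z -> x != z -> False.
  move=> zS bz xz; apply: (@P4_free_path G x a b z) => //.
  - by rewrite adj_sym.
  - exact: nS.
  - by rewrite eq_sym; apply: nS.
  - by rewrite !Sd.
case: (eqVneq x y) => [e|]; last exact: P.
by apply: (P y' y'S by'); rewrite e.
Qed.

(** * Unique and repeated degrees in a neighbourhood *)

Definition uniq_nbh (G : sgraph) (v : G) : {set G} :=
  [set x in nbh v | [forall x' in nbh v, (degree x' == degree x) ==> (x' == x)]].

Definition rep_nbh (G : sgraph) (v : G) : {set G} := nbh v :\: uniq_nbh v.

Lemma uniq_nbhP (G : sgraph) (v x : G) :
  reflect (adj v x /\ forall x', adj v x' -> degree x' = degree x -> x' = x)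
          (x \in uniq_nbh v).
Proof.
rewrite !inE; apply: (iffP andP) => -[vx].
  move/forallP=> h; split=> // x' vx' e; move: (h x'); rewrite inE vx' e eqxx /=.
  by move/eqP.
move=> h; split=> //; apply/forallP=> x'; rewrite inE.
by apply/implyP=> vx'; apply/implyP=> /eqP e; apply/eqP; apply: h.
Qed.

Lemma rep_nbhP (G : sgraph) (v x : G) : x \in rep_nbh v ->
  adj v x /\ exists x', [/\ adj v x', degree x' = degree x & x' != x].
Proof.
rewrite !inE negb_and => /andP[/orP[/negP|] h vx] //; split=> //.
case/forallPn: h => x'; rewrite inE !negb_imply => /and3P[vx' /eqP e n].
by exists x'.
Qed.

Lemma uniq_nbh_sub (G : sgraph) (v x : G) : x \in uniq_nbh v -> adj v x.
Proof. by case/uniq_nbhP. Qed.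

Lemma rep_nbh_sub (G : sgraph) (v x : G) : x \in rep_nbh v -> adj v x.
Proof. by case/rep_nbhP. Qed.

(** Otherwise x a v x' is a forbidden path. *)
Lemma nbh_twin (G : sgraph) (v a x x' : G) : P4_degree_free G ->
  adj v a -> adj v x -> adj v x' -> adj a x -> degree x' = degree x ->
  x' != x -> x' = a.
Proof.
move=> H va vx vx' ax e xx'; apply/eqP; apply: contraT => x'a.
case: (@P4_free_path G x a v x') => //; try by rewrite adj_sym.
- by rewrite eq_sym; apply: adj_neq.
- by rewrite eq_sym.
- by rewrite eq_sym.
Qed.

(** Another vertex with the degree of x would have to be a by [nbh_twin], but the degree of a is
    unique. *)
Lemma uniq_nbh_closed (G : sgraph) (v a x : G) : P4_degree_free G ->
  a \in uniq_nbh v -> adj v x -> adj a x -> x \in uniq_nbh v.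
Proof.
move=> H /uniq_nbhP[va ua] vx ax; apply/uniq_nbhP; split=> // x' vx' e.
apply/eqP; apply: contraT => n.
have e' := nbh_twin H va vx vx' ax e n.
by rewrite e' (ua x vx) ?eqxx // -e e' in n.
Qed.

(** The path argument, started at a, identifies every other vertex of the degree class of a with
    x. *)
Lemma rep_nbh_edge (G : sgraph) (v a x : G) : P4_degree_free G ->
  a \in rep_nbh v -> adj v x -> adj a x ->
  [set y in nbh v | degree y == degree a] \subset [set a; x].
Proof.
move=> H /rep_nbhP[va [a' [va' ea' na']]] vx ax.
have xa : adj x a by rewrite adj_sym.
have ea := nbh_twin H vx va va' xa ea' na'.
apply/subsetP => y; rewrite !inE => /andP[vy /eqP ey].
by case: (eqVneq y a) => //= n; rewrite (nbh_twin H vx va vy xa ey n).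
Qed.

Lemma degree_split (G : sgraph) (v a : G) :
  degree a = #|nbh a :&: nbh v| + #|nbh a :&: ~: nbh v|.
Proof. by rewrite -setDE cardsID. Qed.

Lemma rep_nbh_inner (G : sgraph) (v a : G) : P4_degree_free G ->
  a \in rep_nbh v -> #|nbh a :&: nbh v| <= 1.
Proof.
move=> H aR; apply/card_le1_eqP => x y; rewrite !inE.
case/andP=> ax vx /andP[ay vy].
have [va [a' [va' ea' na']]] := rep_nbhP aR.
have xa : adj x a by rewrite adj_sym.
have ya : adj y a by rewrite adj_sym.
by rewrite -(nbh_twin H vx va va' xa ea' na') -(nbh_twin H vy va va' ya ea' na').
Qed.

Lemma degree_rep_nbh (G : sgraph) (v a : G) : P4_degree_free G ->
  a \in rep_nbh v -> degree a <= #|~: nbh v|.+1.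
Proof.
move=> H aR; rewrite (degree_split v a).
have := rep_nbh_inner H aR.
have : #|nbh a :&: ~: nbh v| <= #|~: nbh v| by apply/subset_leq_card/subsetIr.
lia.
Qed.

(** Such vertices all have degree exactly |W| + 1, and one of them has a neighbour inside N(v), so
    [rep_nbh_edge] puts their common degree class into a pair. *)
Lemma card_rep_nbh_high (G : sgraph) (v : G) : P4_degree_free G ->
  #|[set a in rep_nbh v | #|~: nbh v| < degree a]| <= 2.
Proof.
move=> H; set S := [set a in _ | _].
have [->|[a]] := set_0Vmem S; first by rewrite cards0.
rewrite inE => /andP[aR ha].
have : 0 < #|nbh a :&: nbh v|.
  move: ha; rewrite (degree_split v a).
  have : #|nbh a :&: ~: nbh v| <= #|~: nbh v| by apply/subset_leq_card/subsetIr.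
  lia.
case/card_gt0P=> x; rewrite !inE => /andP[ax vx].
apply: leq_trans (_ : #|[set a; x]| <= 2); last by rewrite cards2; case: eqP.
apply/subset_leq_card/(subset_trans _ (rep_nbh_edge H aR vx ax)).
apply/subsetP=> y; rewrite [y \in S]inE => /andP[yR hy].
have := degree_rep_nbh H yR; have := degree_rep_nbh H aR.
by rewrite !inE (rep_nbh_sub yR) /=; move=> *; apply/eqP; lia.
Qed.

(** * Degree sums over W, U and R *)

Lemma sum_rep_nbh (G : sgraph) (v : G) (w := #|~: nbh v|) : P4_degree_free G ->
  \sum_(a in rep_nbh v) degree a + \sum_(a in rep_nbh v) (w - degree a)
    <= #|rep_nbh v| * w + 2.
Proof.
move=> H; apply: leq_trans (_ : _ <= #|rep_nbh v| * w +
    #|[set a in rep_nbh v | w < degree a]|) _; last first.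
  by rewrite leq_add2l card_rep_nbh_high.
rewrite -sum_nat_const -big_split /= -sum1_card.
rewrite [X in _ + X](eq_bigl (fun x => (x \in rep_nbh v) && (w < degree x))); last first.
  by move=> x; rewrite inE.
rewrite [X in _ + X]big_mkcondr -big_split /=; apply: leq_sum => a aR.
by have := degree_rep_nbh H aR; rewrite -/w; case: ifP; lia.
Qed.

Lemma card_uniq_rep_nbh (G : sgraph) (v : G) :
  #|uniq_nbh v| + #|rep_nbh v| = degree v.
Proof.
rewrite /degree -/(nbh v) -(cardsID (uniq_nbh v) (nbh v)) -/(rep_nbh v).
congr (#|pred_of_set _| + _); apply/esym/setIidPr/subsetP=> x.
by move/uniq_nbh_sub; rewrite inE.
Qed.

Lemma card_nonnbh (G : sgraph) (v : G) : #|~: nbh v| + degree v = #|G|.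
Proof. by rewrite addnC cardsC. Qed.

Lemma sum_degree_split (G : sgraph) (v : G) :
  \sum_(x : G) degree x = \sum_(x in ~: nbh v) degree x
    + \sum_(x in uniq_nbh v) degree x + \sum_(x in rep_nbh v) degree x.
Proof.
rewrite -addnA [RHS]addnC (bigID (mem (nbh v))) /=; congr (_ + _); last first.
  by apply: eq_bigl => x; rewrite !inE.
rewrite (bigID (mem (uniq_nbh v))) /=; congr (_ + _); apply: eq_bigl => x.
  by rewrite !inE; case: (adj v x).
by rewrite !inE; case: (adj v x); rewrite ?andbT ?andbF.
Qed.

Lemma sum_le_const (T : finType) (A : {set T}) (f : T -> nat) (B : nat) :
  {in A, forall x, f x <= B} -> \sum_(x in A) f x <= #|A| * B.
Proof. by move=> fB; rewrite -sum_nat_const; apply: leq_sum. Qed.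

(** * No vertex of U attains the maximum degree *)

(** Here t = |U| - 1, r = |R|, and S is the degree sum over U without y. The two lower bounds on the
    edges conflict: the first gives t^2 <= 2 n + 4 + t, the second n <= 4 t + 7. *)
Lemma max_degree_arith (n w D t r S : nat) :
  100 <= n -> n <= D -> w + D = 2 * n -> t.+1 + r = D ->
  2 * S + t * t.+1 <= 2 * (t * w.+2) ->
  2 * n ^ 2 <= w * D + (D + S) + r * w.+1 + 2 ->
  2 * n ^ 2 <= w * D + t.+1 * D + r * t.+2 + 2 -> False.
Proof.
move=> n100 nD wD trD hS h1 h2.
have [k Dk] : exists k, D = n + k by exists (D - n); lia.
have nk : n = w + k by lia.
have rD : r + t.+1 = w + 2 * k by lia.
rewrite {}Dk {}nk -!mulnn in n100 nD wD trD hS h1 h2 *.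
have e1 : r * w.+1 + t.+1 * w.+1 = (w + 2 * k) * w.+1 by rewrite -mulnDl rD.
have e2 : r * t.+2 <= (w + 2 * k) * t.+2 by rewrite leq_mul2r; lia.
have b1 : t * t + 4 * (k * k) <= 2 * (w + k) + 2 + t + 6 * k.
  clear -hS h1 e1; lia.
have b1' : t * t <= 2 * (w + k) + 4 + t.
  (* This is 2 (2 k - 1) (k - 1) >= 0 for natural k; it removes k from [b1]. *)
  have : 6 * k <= 4 * (k * k) + 2 by clear; case: k => [|[|k]]; nia.
  clear -b1; lia.
have b2 : (w + k) * (w + k) <= 2 * (w + k) * (2 * t + 3) + 2.
  have : k * t <= (w + k) * t by rewrite leq_mul2r; lia.
  clear -h2 e2; lia.
have b3 : w + k <= 4 * t + 7.
  rewrite leqNgt; apply/negP => h; clear -b2 h n100; nia.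
clear -b1' b3 n100; nia.
Qed.

Lemma uniq_nbh_degree_lt_max (G : sgraph) (n : nat) (v y : G) :
  100 <= n -> P4_degree_free G -> (forall x : G, degree x <= degree v) ->
  #|G| = 2 * n -> n <= degree v -> 2 * n ^ 2 <= \sum_(x : G) degree x + 2 ->
  y \in uniq_nbh v -> degree y < degree v.
Proof.
move=> n100 H vmax cG nD sumG yU; rewrite ltn_neqAle vmax andbT.
apply/eqP=> ey; have vy := uniq_nbh_sub yU; have yv : adj y v by rewrite adj_sym.
have noedge a b : adj v a -> a != y -> adj y b -> b != v -> ~~ adj a b.
  move=> va ay yb bv; apply/negP=> ab.
  apply: (@P4_free_path G v a b y) => //.
  - by rewrite adj_sym.
  - by rewrite eq_sym.
  - exact: adj_neq.
pose B := nbh y :\ v.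
have cB : #|B|.+1 = degree v 
  by rewrite -ey /degree -/(nbh y) (cardsD1 v (nbh y)) [v \in _]inE yv.
have cW := card_nonnbh v; rewrite cG in cW.
(* The D - 1 vertices of [B] are not neighbours of a. *)
have dA a : adj v a -> a != y -> degree a <= #|~: nbh v|.+1.
  move=> va ay; have : nbh a \subset ~: B.
    apply/subsetP=> b; rewrite !inE => ab; apply: contraTN ab => /andP[bv yb].
    exact: noedge.
  move/subset_leq_card; have := cardsC B; rewrite /degree -/(nbh a); lia.
(* By closure of U, at most |U| - 1 vertices of [B] lie in N(v), so at least D - |U| lie in W. As
   |W| <= D, at most |U| vertices of W remain for a, plus one neighbour in N(v). *)
have dR a : a \in rep_nbh v -> degree a <= #|uniq_nbh v|.+1.
  move=> aR; have va := rep_nbh_sub aR.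
  have ay : a != y by apply: contraTneq aR => ->; rewrite inE yU.
  have s1 : nbh a :&: ~: nbh v \subset ~: nbh v :\: B.
    apply/subsetP=> b; rewrite !inE => /andP[ab ->]; rewrite andbT.
    by apply: contraTN ab => /andP[bv yb]; apply: noedge.
  have s2 : nbh v :&: B \subset uniq_nbh v :\ y.
    apply/subsetP=> b; rewrite in_setI in_setD1 !inE => /and3P[vb bv yb].
    have := uniq_nbh_closed H yU vb yb.
    by rewrite !inE => ->; rewrite andbT eq_sym adj_neq.
  have e1 := cardsID (nbh v) B; rewrite setDE in e1.
  have e2 := cardsID B (~: nbh v); rewrite setIC in e2.
  have := subset_leq_card s1; have := subset_leq_card s2.
  rewrite (degree_split v a) setIC; have := rep_nbh_inner H aR.
  rewrite (setIC (nbh a) (nbh v)).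
  have := cardsD1 y (uniq_nbh v); rewrite yU; lia.
have cU := cardsD1 y (uniq_nbh v); rewrite yU add1n in cU.
have sU := @distinct_sum_bound _ (uniq_nbh v :\ y) (@degree G) #|~: nbh v|.+2.
apply: (@max_degree_arith n #|~: nbh v| (degree v) #|uniq_nbh v :\ y|
         #|rep_nbh v| (\sum_(x in uniq_nbh v :\ y) degree x)) => //.
- by rewrite -cU card_uniq_rep_nbh.
- apply: sU.
    move=> a b /setD1P[_ aU] /setD1P[_ /uniq_nbhP[vb ub]] e.
    by apply: ub => //; apply: uniq_nbh_sub aU.
  move=> a /setD1P[ay aU]; rewrite ltnS; apply: dA => //.
  exact: uniq_nbh_sub.
- apply: (leq_trans sumG); rewrite leq_add2r (sum_degree_split v).
  rewrite (big_setD1 y yU) /= ey; apply: leq_add; first rewrite leq_add2r.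
    exact: sum_le_const.
  apply: sum_le_const => a aR; apply: dA; first exact: rep_nbh_sub aR.
  by apply: contraTneq aR => ->; rewrite inE yU.
- apply: (leq_trans sumG); rewrite leq_add2r (sum_degree_split v) -cU.
  by apply: leq_add; first apply: leq_add; apply: sum_le_const.
Qed.

(** * Bounded deficits and the bipartite structure *)

Lemma deficit_arith (n w D u r SW SU SR dW dU dR : nat) :
  n <= D -> w + D = 2 * n -> u + r = D ->
  SW + dW = w * D -> SU + dU = u * D -> u * u.+1 <= 2 * dU ->
  SR + dR <= r * w + 2 -> 2 * n ^ 2 <= SW + SU + SR + 2 ->
  [/\ u <= 8, D <= n + 5, dW <= 4, dR <= 4 & dU <= 40].
Proof.
move=> nD wD urD hW hU hU2 hR hS.
have [k Dk] : exists k, D = n + k by exists (D - n); lia.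
have nk : n = w + k by lia.
have e1 : r * w + u * w = D * w by rewrite -mulnDl addnC urD.
rewrite {}Dk {}nk -mulnn in nD wD urD hW hU hU2 hR hS e1 *.
have main : dW + dU + dR + 2 * (k * k) <= 2 * (k * u) + 4.
  clear -hW hU hR hS e1; lia.
(* Equivalently 2 dW + 2 dR + (2 k - u)^2 + u <= 8, which bounds everything but dU. *)
have m2 : 2 * dW + 2 * dR + 4 * (k * k) + u * u + u <= 4 * (k * u) + 8.
  clear -main hU2; lia.
have sq : 4 * (k * u) <= 4 * (k * k) + u * u.
  clear; case: (leqP u (2 * k)) => h; nia.
have u8 : u <= 8 by lia.
have ku : 2 * k <= u + 2.
  rewrite leqNgt; apply/negP => h.
  have [j ej] : exists j, 2 * k = u + j.+3 by exists (2 * k - u - 3); lia.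
  have : (2 * k) * (2 * k) + u * u + u <= 2 * ((2 * k) * u) + 8.
    clear -m2; lia.
  by rewrite ej; clear; nia.
(* From [main] and [sq], dU <= u^2 / 2 + 4 <= 36. *)
have uu : u * u <= 8 * u by rewrite leq_mul2r u8 orbT.
split=> //; lia.
Qed.

Lemma admissible_bipartite (G : sgraph) (n : nat) : 100 <= n -> admissible n G ->
  exists v : G, #|nbh v| = n.+1 /\
    forall x y, adj x y = (x \in ~: nbh v) (+) (y \in ~: nbh v).
Proof.
move=> n100 [cG eG nP].
have H : P4_degree_free G by move=> x y e j; apply: nP; exists x, y.
have sumG : 2 * n ^ 2 <= \sum_(x : G) degree x + 2 by rewrite handshake; lia.
have [x0 _] : exists x0 : G, x0 \in G by apply/card_gt0P; rewrite cG; lia.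
case: (@arg_maxnP _ x0 xpredT (@degree G) isT) => v _ vmax'.
have vmax x : degree x <= degree v := vmax' x isT.
(* Otherwise the degree sum is at most 2 n (n - 1) < 2 n^2 - 2. *)
have nD : n <= degree v.
  rewrite leqNgt; apply/negP=> lt.
  have : \sum_(x : G) degree x <= #|G| * n.-1.
    by rewrite -sum_nat_const; apply: leq_sum => x _; have := vmax x; lia.
  by rewrite cG => le; move: sumG; rewrite -mulnn; nia.
have cW := card_nonnbh v; rewrite cG in cW.
have cN := card_uniq_rep_nbh v.
set W := ~: nbh v in cW *; set U := uniq_nbh v in cN; set R := rep_nbh v in cN.
set w := #|W| in cW *.
pose dW := \sum_(x in W) (degree v - degree x).
pose dU := \sum_(x in U) (degree v - degree x).
pose dR := \sum_(x in R) (w - degree x).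
have hW : \sum_(x in W) degree x + dW = w * degree v by apply: deficitE.
have hU : \sum_(x in U) degree x + dU = #|U| * degree v by apply: deficitE.
have hU2 : #|U| * #|U|.+1 <= 2 * dU.
  have := @distinct_sum_bound _ U (@degree G) (degree v); rewrite -hU.
  suff inj : {in U &, injective (@degree G)}.
    move=> /(_ inj) h; suff : 2 * (\sum_(x in U) degree x) + #|U| * #|U|.+1
      <= 2 * (\sum_(x in U) degree x + dU) by lia.
    apply: h => x; exact: (uniq_nbh_degree_lt_max n100).
  move=> a b /uniq_nbh_sub va /uniq_nbhP[vb ub] e; exact: ub.
have hR := sum_rep_nbh v H; rewrite -/W -/w -/R -/dR in hR.
have hS := sumG; rewrite (sum_degree_split v) in hS.
have [u8 D5 dW4 dR4 dU40] := deficit_arith nD cW cN hW hU hU2 hR hS.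
pose R1 := [set a in R | degree a == w].
(* |R| >= 100 - 8, and at most 2 + 4 vertices of R have a degree other than w. *)
have cR1 : 80 <= #|R1|.
  have := card_lt_deficit R (@degree G) w; rewrite -/dR.
  have := card_rep_nbh_high v H; rewrite -/W -/w -/R.
  set Hi := [set _ in _ | _]; set Lo := [set _ in _ | _] => h1 h2.
  have : #|R| <= #|R1 :|: (Hi :|: Lo)|.
    apply/subset_leq_card/subsetP=> a aR.
    have E (P : pred G) : (a \in [set x in R | P x]) = P a by rewrite inE aR.
    by rewrite !in_setU !E; case: ltngtP.
  have [c1 _] := leq_card_setU R1 (Hi :|: Lo).
  by have [c2 _] := leq_card_setU Hi Lo; lia.
(* A neighbour inside N(v) would confine the large set [R1] to a pair; so the w neighbours of a fill
   W. *)
have R1nbh a : a \in R1 -> nbh a = W.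
  rewrite inE => /andP[aR /eqP da].
  have n0 : nbh a :&: nbh v = set0.
    apply/eqP; rewrite -subset0; apply/subsetP=> x; rewrite in_setI ![_ \in nbh _]inE.
    case/andP=> ax vx; exfalso.
    have /subset_leq_card := rep_nbh_edge H aR vx ax.
    have : #|R1| <= #|[set y in nbh v | degree y == degree a]|.
      apply/subset_leq_card/subsetP=> y; rewrite [y \in R1]inE => /andP[yR ey].
      by rewrite !inE (rep_nbh_sub yR) da.
    have : #|[set a; x]| <= 2 by rewrite cards2; case: eqP.
    lia.
  apply/eqP; rewrite eqEcard -/w -da leqnn andbT.
  by rewrite -[nbh a]setTI -(setUCr (nbh v)) setIC setIUr n0 set0U subsetIr.
have R1W a x : a \in R1 -> x \in W -> adj x a.
  by move=> aR xW; rewrite adj_sym; move: xW; rewrite -(R1nbh a aR) inE.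
have R1N a : a \in R1 -> a \notin W.
  by rewrite inE => /andP[/rep_nbh_sub va _]; rewrite !inE va.
(* Both ends would be adjacent to all of [R1], where the degree is constant. *)
have indepW x y : x \in W -> y \in W -> ~~ adj x y.
  move=> xW yW; apply/negP=> xy.
  have sR z : z \in W -> #|nbh z :&: R1| = #|R1|.
    move=> zW; congr #|pred_of_set _|; apply/setIidPr/subsetP=> a aR.
    by rewrite inE R1W.
  have nR z : z \in W -> z \notin R1 by apply: contraTN => /R1N.
  apply: (@P4_free_nbh2 G R1 w x y) => //; try exact: nR; try (rewrite sR //; lia).
  by move=> a; rewrite inE => /andP[_ /eqP].
pose W1 := [set x in W | degree x == degree v].
have cW1 : #|W :\: W1| <= 4.
  apply: leq_trans dW4; apply: leq_trans (card_lt_deficit _ _ _).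
  apply/subset_leq_card/subsetP=> x; rewrite in_setD !in_set negb_and.
  by case/andP=> /orP[/negP|] h xW //; rewrite xW ltn_neqAle h vmax.
have W1N z : z \in W1 -> ~~ adj v z by rewrite !inE => /andP[].
(* A vertex of U has degree at least D - 40 with at most 8 neighbours in N(v); one of R has degree
   at least w - 4 with at most 1. Either way 20 neighbours in W remain, and only 4 vertices of W
   miss [W1]. *)
have bigN a : adj v a -> 1 < #|nbh a :&: W1|.
  move=> va; have : 20 <= #|nbh a :&: W|.
    have [aU|aU] := boolP (a \in U).
      have := @deficit_le _ U (@degree G) (degree v) a aU; rewrite -/dU.
      have : #|nbh a :&: nbh v| <= #|U|.
        apply/subset_leq_card/subsetP=> x; rewrite in_setI ![_ \in nbh _]inE.
        by case/andP=> ax vx; apply: uniq_nbh_closed aU vx ax.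
      by have := degree_split v a; rewrite -/W; lia.
    have aR : a \in R by rewrite inE aU inE.
    have := @deficit_le _ R (@degree G) w a aR; rewrite -/dR.
    by have := rep_nbh_inner H aR; have := degree_split v a; rewrite -/W; lia.
  have : #|nbh a :&: W| <= #|(nbh a :&: W1) :|: (W :\: W1)|.
    apply/subset_leq_card/subsetP=> x; rewrite in_setI in_setU in_setI in_setD.
    by case/andP=> -> ->; case: (x \in W1).
  by have [] := leq_card_setU (nbh a :&: W1) (W :\: W1); lia.
have indepN a b : adj v a -> adj v b -> ~~ adj a b.
  move=> va vb; apply/negP=> ab.
  apply: (@P4_free_nbh2 G W1 (degree v) a b) => //; try exact: bigN.
  - by move=> x; rewrite inE => /andP[_ /eqP].
  - by apply: contraL va; apply: W1N.
  - by apply: contraL vb; apply: W1N.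
have dN a : adj v a -> degree a <= w.
  move=> va; apply/subset_leq_card/subsetP=> x; rewrite !inE => ax.
  by apply: contraL ax; apply: indepN.
have sN : \sum_(x in U) degree x + \sum_(x in R) degree x <= degree v * w.
  rewrite -cN mulnDl; apply: leq_add; apply: sum_le_const => a.
    by move/uniq_nbh_sub/dN.
  by move/rep_nbh_sub/dN.
(* If D = n = w, then [R1] and [W1] share a degree, and a path r y r' x across the two sides is
   forbidden. *)
have nDneq : degree v != n.
  apply/eqP=> Dn; have wn : w = n by lia.
  have [r [r' [rR r'R rr']]] : exists r r', [/\ r \in R1, r' \in R1 & r != r'].
    by apply/card_gt1P; lia.
  have [x xW1] : exists x, x \in W1.
    apply/card_gt0P; have := cardsID W1 W.
    have : #|W :&: W1| <= #|W1| by apply/subset_leq_card/subsetIr.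
    rewrite -/w; lia.
  have [xW /eqP dx] : x \in W /\ degree x == degree v.
    by move: xW1; rewrite inE => /andP[].
  have [y yW] : exists y, y \in W :\ x.
    by apply/card_gt0P; have := cardsD1 x W; rewrite xW -/w; lia.
  move: yW; rewrite in_setD1 => /andP[yx yW].
  apply: (@P4_free_path G r y r' x) => //.
  - by rewrite adj_sym R1W.
  - exact: R1W.
  - by rewrite adj_sym R1W.
  - by apply: contraTneq xW => <-; apply: R1N.
  - by move: rR; rewrite inE => /andP[_ /eqP->]; rewrite dx; lia.
(* Both sides are independent, so 2 n^2 - 2 <= 2 w D - dW = 2 n^2 - 2 k^2 - dW; as k is nonzero, k =
   1 and dW = 0. *)
have [Dn dW0] : degree v = n.+1 /\ dW = 0.
  have [k Dk] : exists k, degree v = n + k by exists (degree v - n); lia.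
  have nk : n = w + k by lia.
  move: hS hW sN nDneq; rewrite -/W -/U -/R Dk nk -mulnn => hS hW sN kn.
  have : 2 * (k * k) + dW <= 2 by lia.
  by case: k {Dk nk hS hW sN} kn => [|[|k]]; nia.
exists v; split; first by rewrite -Dn.
(* Zero deficit gives x degree |N(v)|, and independence of W keeps its neighbours inside N(v). *)
have WN x : x \in W -> nbh x = nbh v.
  move=> xW; apply/eqP; rewrite eqEcard -/(degree v) -/(degree x).
  have := @deficit_le _ W (@degree G) (degree v) x xW; rewrite -/dW dW0.
  move=> le; apply/andP; split; last by rewrite -subn_eq0; lia.
  apply/subsetP=> y xy; apply: contraLR xy => yN; rewrite inE.
  by apply: indepW; rewrite // inE.
move=> x y; case: (boolP (x \in W)) => xW; case: (boolP (y \in W)) => yW.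
- exact/negbTE/indepW.
- by move: yW; rewrite inE negbK -(WN x xW) inE.
- by move: xW; rewrite inE negbK -(WN y yW) inE adj_sym.
- by move: xW yW; rewrite !inE !negbK => vx vy; apply/negbTE/indepN.
Qed.

(** * Recognising and verifying the complete bipartite graph *)

Lemma bipartite_isomorphic (G : sgraph) (A : {set G}) (a b : nat) :
  #|A| = a -> #|~: A| = b ->
  (forall x y, adj x y = (x \in A) (+) (y \in A)) -> isomorphic G (Kbip a b).
Proof.
move=> ea eb adjA.
(* The map enumerates both sides of G; it is injective between sets of equal size, and its inverse
   is the isomorphism. *)
pose g (z : Kbip a b) : G := match z with
  | inl i => enum_val (cast_ord (esym ea) i)
  | inr j => enum_val (cast_ord (esym eb) j) end.
have gA z : (g z \in A) = if z is inl _ then true else false.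
  case: z => i /=; first exact: enum_valP.
  by have := enum_valP (cast_ord (esym eb) i); rewrite inE => /negbTE.
have gi : injective g.
  move=> z z' e; have := gA z; rewrite e gA.
  case: z z' e => i [] j //= /enum_val_inj /cast_ord_inj -> //.
have [f gK fK] : bijective g.
  by apply: inj_card_bij => //; rewrite card_sum !card_ord -ea -eb cardsC.
exists f; split; first by exists g.
move=> x y; rewrite adjA -{2}(fK x) -{2}(fK y) !gA.
by case: (f x) => ?; case: (f y).
Qed.

Lemma degree_Kbip (a b : nat) (x : Kbip a b) :
  degree x = if x is inl _ then b else a.
Proof.
case: x => i; rewrite /degree.
  rewrite -[RHS](card_ord b) -cardsT -(card_imset _ (@inr_inj 'I_a 'I_b)).
  congr #|pred_of_set _|; apply/setP=> -[j|j]; rewrite inE /=.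
    by apply/esym/negbTE/imsetP=> -[].
  by rewrite imset_f.
rewrite -[RHS](card_ord a) -cardsT -(card_imset _ (@inl_inj 'I_a 'I_b)).
congr #|pred_of_set _|; apply/setP=> -[j|j]; rewrite inE /=.
  by rewrite imset_f.
by apply/esym/negbTE/imsetP=> -[].
Qed.

Lemma card_edges_Kbip (a b : nat) : #|edges (Kbip a b)| = a * b.
Proof.
apply/eqP; rewrite -(eqn_pmul2l (isT : 0 < 2)) -handshake big_sumType /=.
under eq_bigr do rewrite degree_Kbip.
under [X in _ + X]eq_bigr do rewrite degree_Kbip.
by rewrite !sum_nat_const !card_ord mul2n -addnn mulnC [b * a]mulnC.
Qed.

(** A path with three edges ends on opposite sides, whose degrees n + 1 and n - 1 differ. *)
Lemma Kbip_admissible (n : nat) : 0 < n -> admissible n (Kbip n.-1 n.+1).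
Proof.
case: n => // n _; split.
- by rewrite card_sum !card_ord; lia.
- by rewrite card_edges_Kbip -mulnn; lia.
case=> x [y [e [a [b [_]]]]]; move: e; rewrite !degree_Kbip.
by case: x y a b => [?|?] [?|?] [?|?] [?|?] //=; lia.
Qed.

Theorem theorem1p3 :
  exists n0 : nat, 0 < n0 /\
    forall n : nat, n0 <= n ->
      admissible n (Kbip n.-1 n.+1) /\
      forall G : sgraph, admissible n G -> isomorphic G (Kbip n.-1 n.+1).
Proof.
(* The value 100 is a convenient one that leaves slack in the numerical estimates. *)
exists 100; split=> // n n100; split; first by apply: Kbip_admissible; lia.
move=> G aG; have [v [cv adjv]] := admissible_bipartite n100 aG.
have [cG _ _] := aG; apply: bipartite_isomorphic adjv; last by rewrite setCK.
by have := cardsC (nbh v); rewrite cG cv; lia.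
Qed.
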